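(* $\pi(F_6)=2/9$.
   Context: A $3$-graph $G=(V(G),E(G))$ consists of a finite vertex set $V(G)$ and a set $E(G)$ of $3$-element subsets of $V(G)$; $e(G)=|E(G)|$, and the order of $G$ is $|V(G)|$. $F_6$ is the $3$-graph with vertex set $\{1,\dots,6\}$ and edge set $\{123,124,345,156\}$, where $xyz$ abbreviates $\{x,y,z\}$. A $3$-graph is $F_6$-free if it contains no (not necessarily induced) subgraph isomorphic to $F_6$. For $n\geq 3$, $\mathrm{ex}(n,F_6)$ is the maximum of $e(G)$ over all $F_6$-free $3$-graphs $G$ of order $n$. The Turán density is $\pi(F_6)=\lim_{n\to\infty}\mathrm{ex}(n,F_6)/\binom{n}{3}$ (the limit is known to exist). *)

(* Defs.v *)
From HB Require Import structures.
From mathcomp Require Import all_boot all_order all_algebra.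
From mathcomp Require Import boolp classical_sets reals topology.
From mathcomp Require Import normedtype sequences.

Set Implicit Arguments.
Unset Strict Implicit.
Unset Printing Implicit Defensive.

Import Order.TTheory GRing.Theory Num.Theory.
Import numFieldNormedType.Exports.

Record graph3 (T : finType) := Graph3 {
  edges : {set {set T}};
  edges_card3 : [forall e in edges, #|e| == 3] }.

HB.instance Definition _ (T : finType) := [isSub for @edges T].
HB.instance Definition _ (T : finType) := [Finite of graph3 T by <:].

(* The image of F under the injection f is a (not necessarily induced)
   subgraph of G isomorphic to F, and every such subgraph arises this way. *)
Definition contains (S T : finType) (F : graph3 S) (G : graph3 T) : bool :=
  [exists f : {ffun S -> T},
     injectiveb f && ([set f @: (e : {set S}) | e in edges F] \subset edges G)].

Definition graph_free (S T : finType) (F : graph3 S) (G : graph3 T) : bool :=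
  ~~ contains F G.

(* Up to isomorphism every 3-graph of order n has vertex set 'I_n; see
   leq_turan_number below. *)
Definition turan_number (S : finType) (n : nat) (F : graph3 S) : nat :=
  \max_(G : graph3 'I_n | graph_free F G) #|edges G|.

Lemma leq_turan_number (S T : finType) (F : graph3 S) (G : graph3 T) :
  graph_free F G -> #|edges G| <= turan_number #|T| F.
Proof.
move=> FG; pose h (e : {set T}) := enum_rank @: e.
have hI : injective h by apply: imset_inj; exact: enum_rank_inj.
have h3 : [forall e in h @: edges G, #|e| == 3].
  apply/forall_inP => _ /imsetP[e eG ->].
  rewrite card_imset; last exact: enum_rank_inj.
  exact: (forall_inP (edges_card3 G)).
rewrite -(card_imset _ hI).
apply: (leq_bigmax_cond (Graph3 h3)).
apply: contra FG => /existsP[f /andP[/injectiveP fI /fintype.subsetP fG]].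
apply/existsP; exists [ffun x => enum_val (f x)]; apply/andP; split.
  by apply/injectiveP => x y; rewrite !ffunE => /enum_val_inj /fI.
apply/fintype.subsetP => _ /imsetP[e eF ->].
have /imsetP[e' e'G fe] := fG _ (imset_f (fun e : {set S} => f @: e) eF).
suff -> : [ffun x => enum_val (f x)] @: e = e' by [].
apply: hI; rewrite -fe /h -imset_comp; apply: eq_imset => x /=.
by rewrite ffunE enum_valK.
Qed.

Definition turan_ratio (R : realType) (S : finType) (F : graph3 S) (n : nat) : R :=
  ((turan_number n F)%:R / 'C(n, 3)%:R)%R.

(* The value of lim on a divergent real sequence is 0, so an equation giving
   turan_density a nonzero value includes convergence; see cvg_turan_density. *)
Definition turan_density (R : realType) (S : finType) (F : graph3 S) : R :=
  limn (turan_ratio R F).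

Lemma cvg_turan_density (R : realType) (S : finType) (F : graph3 S) (d : R) :
  d != 0%R -> turan_density R F = d -> (turan_ratio R F @ \oo --> d)%classic.
Proof.
move=> /[swap] <- d0.
case: (pselect (cvgn (turan_ratio R F))) => // /dvgP Fd.
have F0 : turan_density R F = 0%R := Fd.
by rewrite F0 eqxx in d0.
Qed.

Definition F6_edges : {set {set 'I_6}} :=
  let e i j k : {set 'I_6} := [set inord i; inord j; inord k] in
  [set e 0 1 2; e 0 1 3; e 2 3 4; e 0 4 5].

Fact F6_edges_card3 : [forall e in F6_edges, #|e| == 3].
Proof.
have c3 (i j k : nat) : i < 6 -> j < 6 -> k < 6 -> i < j < k ->
    #|[set inord i; inord j; inord k] : {set 'I_6}| == 3.
  move=> i6 j6 k6 /andP[ij jk].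
  by rewrite -finset.setUA !cardsU1 cards1 !inE -!(inj_eq val_inj) /= !inordK //
     (ltn_eqF ij) (ltn_eqF jk) (ltn_eqF (ltn_trans ij jk)).
by apply/forall_inP => e; rewrite !inE -!orbA => /or4P[] /eqP->; exact: c3.
Qed.

(* The vertices 1, ..., 6 are shifted to 0, ..., 5. *)
Definition F6 : graph3 'I_6 := Graph3 F6_edges_card3.

(* Main.v *)
Require Import Defs.
From mathcomp Require Import boolp classical_sets topology normedtype sequences.
From mathcomp Require Import zify ring lra.
From mathcomp Require Import all_boot all_order all_algebra reals.

Set Implicit Arguments.
Unset Strict Implicit.
Unset Printing Implicit Defensive.

(** The balanced complete 3-partite 3-graph has density 2/9 in the limit.  It is
    F6-free: in F6 the edges 123 and 124 would put the vertices 3 and 4 into the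
    same part, while 345 puts them into different ones.

    For the upper bound, name the vertices 1, ..., 6 of F6 a, ..., f, so that the
    edges are abc, abd, cde, aef, and consider first a 3-graph E into which F6 has
    no homomorphism at all, injective or not.  Its density is bounded by a
    Lagrangian argument with integer weights.  Among the weightings of the
    vertices of total weight N, take one that maximizes the weighted number of
    triples and, among those, one of smallest support.  Moving weight between two
    vertices that lie in no common triple changes this number linearly, so by
    minimality any two vertices of the support lie in a triple of the support.
    Then no two triples abc, abd of the support share a pair: c and d would lie in
    a triple cde, and a and e (or b and e, if e = a) in a further one, which
    completes a homomorphic image of F6.  So the link of each vertex is a matching.
    Let v be the heaviest vertex, of weight M.  The weight of its link, with
    edges counted in both orders, is at most M(N-M) and at most (N-M)^2/2; one of
    the two is at most 2N^2/9, according to whether M is below or above N/3.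
    Optimality implies that no degree exceeds that of v by more than 2N, and
    summing over the vertices bounds the number of ordered triples by
    2N^3/9 + O(N^2) (form3_F6_hom_free).

    An F6-free 3-graph on n vertices may still receive non-injective homomorphisms
    from F6, but few.  Their images are copies of certain 3-graphs on 4 or 5
    vertices; if there were many such copies, two of them would combine into a
    genuine F6, so that there are only O(n^3) on 4 and O(n^4) on 5 vertices
    (card_fold_25, card_fold_26, card_fold_36).  A random map from m points to the
    vertices, with m fixed and n large, therefore almost always pulls the 3-graph
    back to one with no homomorphism from F6, and averaging the first bound over
    these maps gives the density bound (F6_free_sampling_bound).

    Triples are counted as ordered throughout, so that a density 2/9 reads as
    2n^3/9 triples. *)

(** * Triple systems and weighted counts *)

Definition triple_system (V : Type) (E : V -> V -> V -> bool) :=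
  [/\ forall a b c, E a b c -> E b a c,
      forall a b c, E a b c -> E a c b
    & forall a b c, E a b c -> a <> b].

Definition F6_free (T : eqType) (E : T -> T -> T -> bool) :=
  forall a b c d e f, uniq [:: a; b; c; d; e; f] ->
    E a b c -> E a b d -> E c d e -> E a e f -> False.

Definition F6_hom_free (V : Type) (E : V -> V -> V -> bool) :=
  forall a b c d e f, E a b c -> E a b d -> E c d e -> E a e f -> False.

Section Weights.
Variables (V : finType) (E : V -> V -> V -> bool).
Hypothesis E3 : triple_system E.

Definition form3 (x y z : V -> nat) : nat :=
  \sum_i \sum_j \sum_k E i j k * (x i * y j * z k).

Definition unit_weight (u : V) (i : V) : nat := i == u.

Lemma sum_unit_weight u : \sum_i unit_weight u i = 1.
Proof.
by rewrite (bigD1 u) //= /unit_weight eqxx big1 // => i /negbTE ->.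
Qed.

Definition degree (u : V) (w : V -> nat) := form3 (unit_weight u) w w.

Lemma eq_form3 x x' y y' z z' :
  x =1 x' -> y =1 y' -> z =1 z' -> form3 x y z = form3 x' y' z'.
Proof.
move=> ex ey ez; apply: eq_bigr => i _; apply: eq_bigr => j _.
by apply: eq_bigr => k _; rewrite ex ey ez.
Qed.

Lemma form3C12 x y z : form3 x y z = form3 y x z.
Proof.
case: E3 => E12 _ _.
rewrite /form3 exchange_big; apply: eq_bigr => i _; apply: eq_bigr => j _.
apply: eq_bigr => k _; have -> : E j i k = E i j k by apply/idP/idP; exact: E12.
by rewrite (mulnC (x _)).
Qed.

Lemma form3C23 x y z : form3 x y z = form3 x z y.
Proof.
case: E3 => _ E23 _.
apply: eq_bigr => i _; rewrite exchange_big; apply: eq_bigr => j _.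
apply: eq_bigr => k _; have -> : E i k j = E i j k by apply/idP/idP; exact: E23.
by rewrite mulnAC.
Qed.

Lemma form3Dl x x' y z s :
  form3 (fun i => x i + s * x' i) y z = form3 x y z + s * form3 x' y z.
Proof.
rewrite /form3 big_distrr -big_split; apply: eq_bigr => i _ /=.
rewrite big_distrr -big_split; apply: eq_bigr => j _ /=.
rewrite big_distrr -big_split; apply: eq_bigr => k _ /=.
ring.
Qed.

Lemma form3_unit_unit u x : form3 (unit_weight u) (unit_weight u) x = 0.
Proof.
case: E3 => _ _ E_irr.
rewrite /form3; apply: big1 => i _; apply: big1 => j _; apply: big1 => k _.
rewrite /unit_weight; case: eqP => [->|]; last by rewrite muln0.
case: eqP => [->|]; last by rewrite muln0.
by case: (boolP (E u u k)) => // /E_irr.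
Qed.

(** The form is affine in the weight of a single vertex, since no triple
    repeats a vertex. *)
Lemma form3_add_unit w u s :
  form3 (fun i => w i + s * unit_weight u i) (fun i => w i + s * unit_weight u i)
    (fun i => w i + s * unit_weight u i) = form3 w w w + 3 * s * degree u w.
Proof.
set x := fun i => _; set e := unit_weight u.
have xl y z : form3 x y z = form3 w y z + s * form3 e y z by exact: form3Dl.
have xm y z : form3 y x z = form3 y w z + s * form3 y e z.
  by rewrite form3C12 xl form3C12 (form3C12 e).
have xr y z : form3 y z x = form3 y z w + s * form3 y z e.
  by rewrite form3C23 xm form3C23 (form3C23 _ e).
have e0 z : form3 e e z = 0 by exact: form3_unit_unit.
have e0' z : form3 e z e = 0 by rewrite form3C23.
have e0'' z : form3 z e e = 0 by rewrite form3C12.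
rewrite xl !xm !xr !e0 !e0' !e0'' /degree (form3C12 w e) (form3C23 w w) (form3C12 w e).
ring.
Qed.

Lemma degree_add_unit w u v s :
  degree v (fun i => w i + s * unit_weight u i) =
  degree v w + 2 * s * form3 (unit_weight v) (unit_weight u) w.
Proof.
rewrite /degree; set e := unit_weight u; set x := fun i => _.
have xm y z : form3 y x z = form3 y w z + s * form3 y e z.
  by rewrite form3C12 form3Dl form3C12 (form3C12 e).
have e0 : form3 (unit_weight v) e e = 0.
  by rewrite form3C12 form3C23 form3_unit_unit.
rewrite xm form3C23 xm (form3C23 _ e x) xm e0 (form3C23 _ w e).
ring.
Qed.

Lemma degreeE u w : degree u w = \sum_j \sum_k E u j k * (w j * w k).
Proof.
rewrite /degree /form3 (bigD1 u) //= [X in _ + X]big1 ?addn0.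
  by apply: eq_bigr => j _; apply: eq_bigr => k _; rewrite /unit_weight eqxx mul1n.
move=> i /negbTE iu; apply: big1 => j _; apply: big1 => k _.
by rewrite /unit_weight iu muln0.
Qed.

Lemma form3_sum_degree w : form3 w w w = \sum_u w u * degree u w.
Proof.
apply: eq_bigr => u _; rewrite degreeE big_distrr; apply: eq_bigr => j _ /=.
rewrite big_distrr; apply: eq_bigr => k _ /=.
ring.
Qed.

Lemma codegreeE u v w :
  form3 (unit_weight u) (unit_weight v) w = \sum_k E u v k * w k.
Proof.
rewrite /form3 (bigD1 u) //= [X in _ + X]big1 ?addn0.
  rewrite (bigD1 v) //= [X in _ + X]big1 ?addn0.
    by apply: eq_bigr => k _; rewrite /unit_weight !eqxx !mul1n.
  move=> j /negbTE jv; apply: big1 => k _.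
  by rewrite /unit_weight jv !muln0.
move=> i /negbTE iu; apply: big1 => j _; apply: big1 => k _.
by rewrite /unit_weight iu muln0.
Qed.

Lemma codegree_le u v w :
  form3 (unit_weight u) (unit_weight v) w <= \sum_k w k.
Proof.
by rewrite codegreeE; apply: leq_sum => k _; case: (E _ _ _); rewrite ?mul1n.
Qed.

Lemma form3_le w : form3 w w w <= (\sum_k w k) ^ 3.
Proof.
rewrite /form3 expnS expnS expn1 big_distrl; apply: leq_sum => i _ /=.
rewrite big_distrl big_distrr; apply: leq_sum => j _ /=.
rewrite big_distrr big_distrr; apply: leq_sum => k _ /=.
by case: (E _ _ _); rewrite ?mul0n ?mul1n //= mulnA.
Qed.

End Weights.

(** * Weighted matchings *)

(** Charging each edge to its ends gives the first bound.  For the second, let Q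
    be the sum of the squared weights of the matched vertices: D <= Q since
    2xy <= x^2 + y^2, and D + Q <= S^2 since an edge contributes distinct
    off-diagonal terms to the square of S.  The first is sharp when all matched
    weights are M, the second for a single edge of equal weights. *)
Lemma matching_sum (V : finType) (L : rel V) (w : V -> nat) M :
    symmetric L -> irreflexive L ->
    (forall j k k', L j k -> L j k' -> k = k') -> (forall j, w j <= M) ->
  let S := \sum_(j | [exists k, L j k]) w j in
  let D := \sum_j \sum_k L j k * (w j * w k) in
  D <= M * S /\ 2 * D <= S ^ 2.
Proof.
move=> Ls Li Lm wM S D.
have inner (j : V) (F : V -> nat) B : (forall k, L j k -> F k <= B) ->
    \sum_k L j k * F k <= [exists k, L j k] * B.
  move=> FB; case: existsP => [[k0 jk0]|nk]; last first.
    rewrite big1 // => k _; case: (boolP (L j k)) => // jk.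
    by case: nk; exists k.
  rewrite (bigD1 k0) //= jk0 big1 ?addn0 ?mul1n ?FB // => k kk0.
  by case: (boolP (L j k)) => // jk; rewrite (Lm _ _ _ jk jk0) eqxx in kk0.
have SE (F : V -> nat) : \sum_(j | [exists k, L j k]) F j = \sum_j [exists k, L j k] * F j.
  by rewrite big_mkcond; apply: eq_bigr => j _; case: ifP; rewrite ?mul1n.
split.
  rewrite /S SE big_distrr; apply: leq_sum => j _ /=.
  apply: leq_trans (inner _ _ (M * w j) _) _; last by rewrite mulnCA.
  by move=> k _; rewrite mulnC leq_mul.
pose Q := \sum_(j | [exists k, L j k]) w j ^ 2.
have DQ : D <= Q.
  have h1 : \sum_j \sum_k L j k * w j ^ 2 <= Q.
    by rewrite /Q SE; apply: leq_sum => j _; apply: inner.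
  have h2 : \sum_j \sum_k L j k * w k ^ 2 = \sum_j \sum_k L j k * w j ^ 2.
    rewrite exchange_big; apply: eq_bigr => j _; apply: eq_bigr => k _.
    by rewrite Ls.
  have h3 : 2 * D <= \sum_j \sum_k L j k * w j ^ 2 + \sum_j \sum_k L j k * w k ^ 2.
    rewrite -big_split big_distrr; apply: leq_sum => j _ /=.
    rewrite -big_split big_distrr; apply: leq_sum => k _ /=.
    case: (L j k); rewrite ?mul0n ?muln0 ?mul1n //=.
    by have [] := nat_Cauchy (w j) (w k).
  lia.
have QS : D + Q <= S ^ 2.
  rewrite /S SE expnS expn1 big_distrl /D /Q SE -big_split.
  apply: leq_sum => j _ /=; rewrite -mulnA big_distrr /=.
  case: (boolP [exists k, L j k]) => [ej|nj]; last first.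
    rewrite !mul0n addn0 big1 // => k _; case: (boolP (L j k)) => // jk.
    by case/existsP: nj; exists k.
  rewrite !mul1n (bigD1 j) //= Li mul0n add0n.
  rewrite [X in _ <= X](bigD1 j) //= ej mul1n mulnn [leqRHS]addnC leq_add2r.
  apply: leq_sum => k _; case: (boolP (L j k)) => //= jk.
  have -> : [exists k0, L k k0] by apply/existsP; exists j; rewrite Ls.
  by rewrite !mul1n.
lia.
Qed.

(** * Weightings of a 3-graph with no homomorphism from F6 *)

Section IntegerLagrangian.
Variables (V : finType) (E : V -> V -> V -> bool).
Hypotheses (E3 : triple_system E) (EF : F6_hom_free E).

Definition support_covers_pairs (w : V -> nat) :=
  forall i j, 0 < w i -> 0 < w j -> i != j -> exists2 k, E i j k & 0 < w k.

(** If k and k' differ, a triple kk'e and a triple on v and e complete vjk and vjk'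
    to a homomorphic image of F6.  When e = v, exchanging the roles of v and j
    lets the triple jvk itself serve as the last one. *)
Lemma link_matching (w : V -> nat) v :
    support_covers_pairs w -> 0 < w v ->
  forall j k k', E v j k -> E v j k' -> 0 < w j -> 0 < w k -> 0 < w k' -> k = k'.
Proof.
case: E3 => E12 E23 _ cov v0 j k k' jk jk' j0 k0 k'0.
apply/eqP/negPn/negP => kk'.
have [e kk'e e0] := cov _ _ k0 k'0 kk'.
have [ve|ve] := eqVneq v e; last first.
  by have [f vef _] := cov _ _ v0 e0 ve; exact: EF jk jk' kk'e vef.
rewrite -ve in kk'e.
exact: (EF (E12 _ _ _ jk) (E12 _ _ _ jk') kk'e (E12 _ _ _ jk)).
Qed.

(** With N the total weight and M = w v, the two bounds of matching_sum are
    M(N-M) and (N-M)^2/2.  They meet at M = N/3, with value 2N^2/9; the first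
    increases up to that point and the second decreases from it on. *)
Lemma degree_bound (w : V -> nat) v :
    support_covers_pairs w -> 0 < w v -> (forall u, w u <= w v) ->
  9 * degree E v w <= 2 * (\sum_i w i) ^ 2.
Proof.
case: (E3) => E12 E23 E_irr cov v0 vmax.
pose L j k := [&& E v j k, 0 < w j & 0 < w k].
have Ls : symmetric L.
  suff Ls j k : L j k -> L k j by move=> j k; apply/idP/idP; exact: Ls.
  by case/and3P=> /E23 jk j0 k0; apply/and3P.
have Li : irreflexive L.
  move=> j; apply/negbTE/and3P => -[/E12/E23 jj _ _].
  by case: (E_irr _ _ _ jj).
have Lm j k k' : L j k -> L j k' -> k = k'.
  case/and3P=> jk j0 k0 /and3P[jk' _ k'0].
  exact: (link_matching cov v0 jk jk').
have [] := matching_sum Ls Li Lm vmax.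
set D := \sum_j _; set S := \sum_(j | _) _ => DM DS.
have -> : degree E v w = D.
  rewrite degreeE /D; apply: eq_bigr => j _ /=; apply: eq_bigr => k _.
  rewrite /L; case: (E _ _ _) => //=.
  by case: (w j) => [|?]; case: (w k) => [|?]; rewrite ?mul0n ?muln0.
have SN : S + w v <= \sum_i w i.
  rewrite [leqRHS](bigD1 v) //= addnC leq_add2l.
  rewrite /S big_mkcond [leqRHS]big_mkcond; apply: leq_sum => j _.
  case: ifP => // /existsP[k /and3P[vjk _ _]].
  by have /eqP := E_irr _ _ _ vjk; rewrite eq_sym => ->.
move: (\sum_i w i) (w v) S D SN DM DS {Ls Li Lm} => N M S D SN DM DS.
by have [M3|M3] := leqP (3 * M) N; nia.
Qed.

Definition optimal (w : V -> nat) :=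
  forall w' : V -> nat, \sum_i w' i = \sum_i w i ->
    form3 E w' w' w' <= form3 E w w w /\
    (form3 E w w w <= form3 E w' w' w' ->
       #|[pred i | w' i == 0]| <= #|[pred i | w i == 0]|).

Lemma exists_optimal (w0 : V -> nat) :
  exists2 w : V -> nat, \sum_i w i = \sum_i w0 i & optimal w.
Proof.
pose N := \sum_i w0 i.
(* As #|V|.+1 exceeds the number of vertices of weight 0, maximizing f maximizes
   the form first and the number of such vertices second. *)
pose f (w : V -> nat) := form3 E w w w * #|V|.+1 + #|[pred i | w i == 0]|.
pose P n := `[< exists2 w : V -> nat, \sum_i w i = N & f w = n >].
have exP : exists n, P n by exists (f w0); apply/asboolP; exists w0.
have boundP n : P n -> n <= N ^ 3 * #|V|.+1 + #|V|.
  move=> /asboolP[w wN <-]; rewrite leq_add ?max_card // leq_mul2r.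
  by rewrite -wN form3_le.
case: (ex_maxnP exP boundP) => _ /asboolP[w wN <-] wmax.
exists w => // w'; rewrite wN => w'N.
have fww' : f w' <= f w by apply: wmax; apply/asboolP; exists w'.
rewrite /f in fww'; split.
  move: (form3 E w w w) (form3 E w' w' w') (max_card [pred i | w i == 0]) fww'.
  move: #|_| #|_| #|_| => K z z' A A' zK fww'; rewrite leqNgt; apply/negP => lt.
  by have := leq_mul lt (leqnn K.+1); rewrite mulSn; lia.
by move=> le; have := leq_mul le (leqnn #|V|.+1); lia.
Qed.

(** If i and j lay in no triple of the support, shifting all the weight of the one
    of smaller degree to the other would not decrease the form, and would shrink
    the support. *)
Lemma optimal_covers_pairs w : optimal w -> support_covers_pairs w.
Proof.
move=> wopt i j wi wj ij.
have [/existsP[k /andP[]]|nk] := boolP [exists k, E i j k && (0 < w k)].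
  by exists k.
have {}nk k : E i j k -> w k = 0.
  move=> ijk; apply/eqP; rewrite -leqn0 leqNgt; apply/negP => wk.
  by case/existsP: nk; exists k; rewrite ijk.
exfalso.
(* z i j is w with the weights of i and j removed; as no triple of the support
   contains both, the form is affine in these two weights. *)
pose z (i j k : V) := if (k == i) || (k == j) then 0 else w k.
wlog degji : i j wi wj ij nk / degree E j (z i j) <= degree E i (z i j).
  move=> gen; have [ji|/ltnW ij'] := leqP (degree E j (z i j)) (degree E i (z i j)).
    exact: gen ji.
  have zC : z i j =1 z j i by move=> k; rewrite /z orbC.
  apply: (gen j i) => //; first by rewrite eq_sym.
    by case: (E3) => E12 _ _ k /E12; exact: nk.
  by rewrite /degree -!(eq_form3 _ (frefl _) zC zC).
set r := z i j in degji.
have wE k : w k = r k + w i * unit_weight i k + w j * unit_weight j k.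
  rewrite /r /z /unit_weight; case: (eqVneq k i) => [->|_] /=.
    by rewrite (negbTE ij) /=; lia.
  by case: (eqVneq k j) => [->|_] /=; lia.
pose w' k := r k + (w i + w j) * unit_weight i k.
have w'N : \sum_k w' k = \sum_k w k.
  rewrite [RHS](eq_bigr _ (fun k _ => wE k)) !big_split -!big_distrr /=.
  by rewrite !sum_unit_weight; lia.
have w'w : form3 E w w w <= form3 E w' w' w'.
  rewrite (eq_form3 _ wE wE wE) !form3_add_unit // degree_add_unit //.
  rewrite codegreeE // big1; last first.
    move=> k _; rewrite /r /z; case: (boolP (E j i k)) => // jik.
    by case: (E3) => E12 _ _; rewrite (nk k (E12 _ _ _ jik)) if_same.
  by nia.
have [_ /(_ w'w)] := wopt _ w'N; apply/negP; rewrite -ltnNge.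
apply: proper_card; apply/properP; split.
  apply/fintype.subsetP => k; rewrite !inE /w' /r /z /unit_weight.
  case: (eqVneq k i) => [->|_]; first by lia.
  by rewrite muln0 addn0; case: (k == j).
exists j; rewrite !inE; last by lia.
by rewrite /w' /r /z /unit_weight eqxx orbT (eq_sym j i) (negbTE ij); lia.
Qed.

(** Moving one unit of weight from v to u does not increase the form.  Hence, with
    that unit removed, the degree of u is at most that of v; putting it back adds to
    the degree of u only the triples on both u and v. *)
Lemma optimal_degree_le w u v : optimal w -> 0 < w v ->
  degree E u w <= degree E v w + 2 * \sum_k w k.
Proof.
move=> wopt wv.
pose r k := w k - unit_weight v k.
have wE k : w k = r k + 1 * unit_weight v k.
  by rewrite /r /unit_weight; case: eqP => [->|_] /=; lia.
pose w' k := r k + 1 * unit_weight u k.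
have w'N : \sum_k w' k = \sum_k w k.
  by rewrite [RHS](eq_bigr _ (fun k _ => wE k)) !big_split /= !sum_unit_weight.
have [+ _] := wopt _ w'N; rewrite (eq_form3 _ wE wE wE) !form3_add_unit //.
have degE z : degree E z w = degree E z (fun k => r k + 1 * unit_weight v k).
  exact: eq_form3.
rewrite !degE !degree_add_unit //.
have := codegree_le E u v r.
have : \sum_k r k <= \sum_k w k by apply: leq_sum => k _; exact: leq_subr.
by lia.
Qed.

Theorem form3_F6_hom_free (w : V -> nat) :
  9 * form3 E w w w <= 2 * (\sum_i w i) ^ 3 + 18 * (\sum_i w i) ^ 2.
Proof.
have [w' w'N w'opt] := exists_optimal w.
have [w_le _] := w'opt _ (esym w'N).
apply: (@leq_trans (9 * form3 E w' w' w')); first by rewrite leq_mul2l w_le.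
rewrite -{}w'N {w_le}; move: w' w'opt => {}w wopt; set N := \sum_i w i.
have [N0|N0] := posnP N.
  by have := form3_le E w; rewrite -/N N0; lia.
have [i0 wi0] : exists i, 0 < w i.
  apply/existsP; rewrite -[X in is_true X]negbK negb_exists; apply/negP => /forallP w0.
  by move: N0; rewrite /N big1 // => i _; apply/eqP; rewrite -leqn0 leqNgt w0.
case: (@arg_maxnP _ i0 xpredT w isT) => v _ vmax.
have wv : 0 < w v by apply: leq_trans wi0 _; exact: vmax.
have := degree_bound (optimal_covers_pairs wopt) wv (fun u => vmax u isT).
rewrite -/N => degv.
have : form3 E w w w <= N * (degree E v w + 2 * N).
  rewrite form3_sum_degree {1}/N big_distrl; apply: leq_sum => u _ /=.
  by rewrite leq_mul2l optimal_degree_le // orbT.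
by move=> bound; nia.
Qed.

End IntegerLagrangian.

(** * Sums over tuples *)

Lemma sum_tuple_cons (T : finType) k (F : seq T -> nat) :
  \sum_(t : k.+1.-tuple T) F t = \sum_x \sum_(t : k.-tuple T) F (x :: t).
Proof.
rewrite pair_big /= (reindex (fun p : T * k.-tuple T => [tuple of p.1 :: p.2])) //=.
exists (fun t => (thead t, [tuple of behead t])) => [[x t] _|t _] /=.
  by congr pair; apply: val_inj.
by rewrite -tuple_eta.
Qed.

Lemma sum_tuple0 (T : finType) (F : seq T -> nat) :
  \sum_(t : 0.-tuple T) F t = F [::].
Proof.
rewrite (bigD1 [tuple]) //= big1 ?addn0 // => t /eqP[].
exact: tuple0.
Qed.

Lemma sum_tuple3 (T : finType) (F : seq T -> nat) :
  \sum_(t : 3.-tuple T) F t = \sum_a \sum_b \sum_c F [:: a; b; c].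
Proof.
rewrite (sum_tuple_cons _ F); apply: eq_bigr => a _.
rewrite (sum_tuple_cons _ (fun s => F (a :: s))); apply: eq_bigr => b _.
rewrite (sum_tuple_cons _ (fun s => F [:: a, b & s])); apply: eq_bigr => c _.
by rewrite (sum_tuple0 (fun s => F [:: a, b, c & s])).
Qed.

Lemma sum_tuple4 (T : finType) (F : seq T -> nat) :
  \sum_(t : 4.-tuple T) F t = \sum_a \sum_b \sum_c \sum_d F [:: a; b; c; d].
Proof.
rewrite (sum_tuple_cons _ F); apply: eq_bigr => a _.
by rewrite (sum_tuple3 (fun s => F (a :: s))).
Qed.

Lemma card_tupleE (T : finType) k (Q : pred (seq T)) :
  #|[set t : k.-tuple T | Q t]| = \sum_(t : k.-tuple T) Q t.
Proof. by rewrite -sum1_card big_mkcond; apply: eq_bigr => t _; rewrite inE; case: (Q t). Qed.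

Lemma card_head_determined (T : finType) k (Q : pred (seq T)) :
    (forall x y s, Q (x :: s) -> Q (y :: s) -> x = y) ->
  #|[set t : k.+1.-tuple T | Q t]| <= #|T| ^ k.
Proof.
move=> Qdet; rewrite -card_tuple.
rewrite -(@card_in_imset _ _ (fun t : k.+1.-tuple T => [tuple of behead t])).
  exact: max_card.
move=> s t; case/tupleP: s => x s; case/tupleP: t => y t.
rewrite !inE /= => Qs Qt /(congr1 val) /= st; apply: val_inj => /=.
by move: Qt; rewrite -st => Qt; rewrite (Qdet _ _ _ Qs Qt).
Qed.

(** * Degenerate copies of F6 in an F6-free 3-graph *)

(** In the bipartite graph P, an edge bc with another edge b'c at c allows b only the
    neighbours c and b'.  So each edge has its first end of degree at most 2 or its
    second end of degree at most 1. *)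
Lemma card_no_path3 (T : finType) (P : rel T) :
    (forall b b' c c', P b c -> P b' c -> P b' c' ->
       b != b' -> c != c' -> b != c' -> False) ->
  \sum_b \sum_c P b c <= 3 * #|T|.
Proof.
move=> nopath.
have split_sum b c : P b c <=
    (#|[pred c' | P b c']| <= 2) && P b c + (#|[pred b' | P b' c]| <= 1) && P b c.
  case Pbc : (P b c); rewrite ?andbF // !andbT.
  have [//|b3] := leqP #|[pred c' | P b c']| 2.
  have [//|c2] := leqP #|[pred b' | P b' c]| 1; exfalso.
  have [b' /andP[Pb'c b'b]] : exists b', P b' c && (b' != b).
    apply/existsP; apply: contraTT c2 => /existsPn nb; rewrite -leqNgt -(card1 b).
    apply/subset_leq_card/fintype.subsetP => b'; rewrite !inE => Pb'c.
    by have := nb b'; rewrite Pb'c negbK.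
  have [c' /and3P[Pbc' cc' b'c']] : exists c', [&& P b c', c' != c & c' != b'].
    apply/existsP; apply: contraTT b3 => /existsPn nc; rewrite -leqNgt.
    apply: leq_trans (_ : #|[pred x in [:: c; b']]| <= 2); last exact: card_size.
    apply/subset_leq_card/fintype.subsetP => c'; rewrite !inE => Pbc'.
    by have := nc c'; rewrite Pbc' /= -negb_or negbK.
  by apply: (nopath b' b c c'); rewrite // eq_sym.
apply: leq_trans (leq_sum _ (fun b _ => leq_sum _ (fun c _ => split_sum b c))) _.
under eq_bigr do rewrite big_split /=.
rewrite big_split /= (_ : 3 * #|T| = #|T| * 2 + #|T| * 1); last by lia.
apply: leq_add; last rewrite exchange_big /=.
  rewrite -sum_nat_const; apply: leq_sum => b _.
  have [b2|_] := leqP #|[pred c' | P b c']| 2; last by rewrite big1.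
  by apply: leq_trans b2; rewrite -sum1_card [leqRHS]big_mkcond leq_sum.
rewrite -sum_nat_const; apply: leq_sum => c _.
have [c1|_] := leqP #|[pred b' | P b' c]| 1; last by rewrite big1.
by apply: leq_trans c1; rewrite -sum1_card [leqRHS]big_mkcond leq_sum.
Qed.

Section DegenerateCopies.
Variables (T : finType) (E : T -> T -> T -> bool).
Hypothesis E3 : triple_system E.
Hypothesis EF : F6_free E.

(** fold_ij is the image of F6 under the identification of its vertices i and j,
    except that in fold_25, which is K4 minus an edge, f is not mentioned because
    abc can serve as the image of aef.  Identifying 4 and 6 gives fold_36 with c
    and d exchanged.  The order of the vertices prepares the counting: the leading
    vertex of fold_26 and fold_36 will be determined by the others. *)
Definition fold_25 (s : seq T) : bool :=
  if s is [:: a; d; b; c] then [&& E a b c, E a b d & E c d b] else false.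

Definition fold_26 (s : seq T) : bool :=
  if s is [:: b; a; c; d; e] then [&& E a b c, E a b d, E c d e & E a e b] else false.

Definition fold_36 (s : seq T) : bool :=
  if s is [:: c; a; b; d; e] then
    [&& E a b c, E a b d, E c d e, E a e c & b != e] else false.

Lemma triple_neq a b c : E a b c -> [&& a != b, b != c & a != c].
Proof.
case: E3 => E12 E23 Ei abc; apply/and3P; split; apply/eqP.
- exact: Ei abc.
- exact: Ei (E23 _ _ _ (E12 _ _ _ abc)).
- exact: Ei (E23 _ _ _ abc).
Qed.

(** Fix a and d, and join b to c when they complete a and d to a fold.  A path
    b, c, b', c' with b != c' gives the copy a, b, c, d, b', c' of F6. *)
Lemma card_fold_25 : #|[set t : 4.-tuple T | fold_25 t]| <= 3 * #|T| ^ 3.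
Proof.
rewrite card_tupleE (sum_tuple4 (fun s => fold_25 s)) /=.
have ad a d : \sum_b \sum_c [&& E a b c, E a b d & E c d b] <= 3 * #|T|.
  apply: (@card_no_path3 T (fun b c => [&& E a b c, E a b d & E c d b])).
  move=> b b' c c' /and3P[abc abd cdb] /and3P[ab'c ab'd cdb'] /and3P[ab'c' _ c'db'].
  move=> bb' cc' bc'; apply: (EF _ abc abd cdb' ab'c').
  move: (triple_neq abc) (triple_neq abd) (triple_neq cdb') (triple_neq ab'c') (triple_neq c'db').
  do 5!case/and3P=> ? ? ?.
  by rewrite /= !inE !negb_or -!andbA; do ?[apply/andP; split]; rewrite // eq_sym.
rewrite (_ : 3 * #|T| ^ 3 = \sum_(a : T) \sum_(d : T) 3 * #|T|); last first.
  by rewrite !sum_nat_const !cardT -!cardE; ring.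
by apply: leq_sum => a _; apply: leq_sum => d _; exact: ad.
Qed.

(** Two values b, b' completing the same a, c, d, e give the copy
    a, b, c, d, e, b' of F6; likewise for c, c' in fold_36. *)
Lemma card_fold_26 : #|[set t : 5.-tuple T | fold_26 t]| <= #|T| ^ 4.
Proof.
apply: card_head_determined => b b' [|a [|c [|d [|e [|? ?]]]]] //=.
case/and4P=> abc abd cde aeb /and4P[ab'c ab'd _ aeb'].
apply/eqP/negPn/negP => bb'.
apply: (EF _ abc abd cde aeb').
move: (triple_neq abc) (triple_neq abd) (triple_neq cde) (triple_neq aeb') (triple_neq aeb) (triple_neq ab'c) (triple_neq ab'd).
do 7!case/and3P=> ? ? ?.
by rewrite /= !inE !negb_or -!andbA; do ?[apply/andP; split]; rewrite // eq_sym.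
Qed.

Lemma card_fold_36 : #|[set t : 5.-tuple T | fold_36 t]| <= #|T| ^ 4.
Proof.
apply: card_head_determined => c c' [|a [|b [|d [|e [|? ?]]]]] //=.
case/and5P=> abc abd cde aec be /and5P[abc' _ c'de aec' _].
apply/eqP/negPn/negP => cc'.
apply: (EF _ abc abd cde aec').
move: (triple_neq abc) (triple_neq abd) (triple_neq cde) (triple_neq aec') (triple_neq abc') (triple_neq c'de).
do 6!case/and3P=> ? ? ?.
by rewrite /= !inE !negb_or -!andbA; do ?[apply/andP; split]; rewrite // eq_sym.
Qed.

(** The only pairs of vertices of F6 in no common edge are 25, 26, 36 and 46, so a
    non-injective homomorphism identifies one of them. *)
Lemma hom_F6_degenerate a b c d e f : E a b c -> E a b d -> E c d e -> E a e f ->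
  [\/ fold_25 [:: a; d; b; c], fold_26 [:: b; a; c; d; e],
      fold_36 [:: c; a; b; d; e] | fold_36 [:: d; a; b; c; e]].
Proof.
case: (E3) => E12 E23 Ei abc abd cde aef /=.
rewrite abc abd cde (E12 _ _ _ cde) /=.
have [be|be] := eqVneq b e; first by rewrite be cde; apply: Or41.
have [bf|bf] := eqVneq b f; first by rewrite bf aef; apply: Or42.
have [cf|cf] := eqVneq c f; first by rewrite cf aef; apply: Or43.
have [df|df] := eqVneq d f; first by rewrite df aef; apply: Or44.
case: (EF _ abc abd cde aef).
move: (triple_neq abc) (triple_neq abd) (triple_neq cde) (triple_neq aef).
do 4!case/and3P=> ? ? ?.
by rewrite /= !inE !negb_or -!andbA; do ?[apply/andP; split]; rewrite // eq_sym.
Qed.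

End DegenerateCopies.

(** * Sampling *)

Section Sampling.
Variables (I T : finType) (k : nat) (s : k.-tuple I).
Hypothesis s_uniq : uniq s.

Lemma card_ffun_prescribed (t : k.-tuple T) :
  #|[set phi : {ffun I -> T} | map phi s == t]| = #|T| ^ (#|I| - k).
Proof.
case: (pickP T) => [x0 _|T0]; last first.
  case: k s t s_uniq => [|k'] s' t us.
    rewrite subn0 -card_ffun -cardsT; apply: eq_card => phi; rewrite !inE.
    by rewrite (tuple0 s') (tuple0 t).
  by have := T0 (thead t).
pose F i : pred T := fun x => (i \in s) ==> (x == nth x0 t (index i s)).
have FE i x : (x \in F i) = (i \in s) ==> (x == nth x0 t (index i s)) by [].
have -> : #|[set phi : {ffun I -> T} | map phi s == t]| = #|family F|.
  apply: eq_card => phi; rewrite !inE; apply/eqP/familyP => [st i|Fphi].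
    apply/implyP => i_s; rewrite -st (nth_map i) ?index_mem //.
    by rewrite nth_index.
  apply: (@eq_from_nth _ x0); first by rewrite size_map !size_tuple.
  rewrite size_map => j js; have i0 : I by case: (val s) js => [|i ?] //.
  rewrite (nth_map i0) //; have := Fphi (nth i0 s j).
  by rewrite FE mem_nth //= index_uniq // => /eqP.
rewrite card_family foldrE big_map.
have -> : \prod_(i <- enum I) #|F i| = \prod_(i : I) (if i \notin s then #|T| else 1).
  rewrite big_enum; apply: eq_bigr => i _; case: ifPn => [/negbTE|/negbNE] i_s.
    by apply: eq_card => x; rewrite FE i_s.
  rewrite -(card1 (nth x0 t (index i s))); apply: eq_card => x.
  by rewrite FE i_s.
rewrite -big_mkcond /= prod_nat_const; congr (_ ^ _).
rewrite -(cardC (mem (val s))) (card_uniqP s_uniq) size_tuple addKn.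
exact: eq_card.
Qed.

Lemma card_sample (Q : pred (seq T)) :
  #|[set phi : {ffun I -> T} | Q (map phi s)]| =
  #|[set t : k.-tuple T | Q t]| * #|T| ^ (#|I| - k).
Proof.
rewrite -sum1_card (partition_big (fun phi : {ffun I -> T} => [tuple of map phi s])
  (mem [set t : k.-tuple T | Q t])) /=; last by move=> phi; rewrite !inE.
rewrite -sum_nat_const; apply: eq_bigr => t; rewrite inE => Qt.
rewrite -(card_ffun_prescribed t) -sum1_card; apply: eq_bigl => phi.
by rewrite !inE -val_eqE /=; case: eqP => [->|]; rewrite ?Qt ?andbF.
Qed.

End Sampling.

Lemma card_sample_some (I T : finType) k (Q : pred (seq T)) :
  #|[set phi : {ffun I -> T} | [exists s : k.-tuple I, uniq s && Q (map phi s)]]|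
    <= #|I| ^ k * (#|[set t : k.-tuple T | Q t]| * #|T| ^ (#|I| - k)).
Proof.
set c := (X in _ * X); have -> : #|I| ^ k * c = \sum_(s : k.-tuple I) c.
  by rewrite sum_nat_const card_tuple.
apply: leq_trans (_ : #|\bigcup_(s : k.-tuple I)
   [set phi : {ffun I -> T} | uniq s && Q (map phi s)]| <= _).
  apply/subset_leq_card/fintype.subsetP => phi; rewrite inE => /existsP[s ss].
  by apply/bigcupP; exists s; rewrite ?inE.
apply: leq_trans (_ : \sum_(s : k.-tuple I)
   #|[set phi : {ffun I -> T} | uniq s && Q (map phi s)]| <= _).
  elim/big_ind2: _ => [|A x B y Ax By|//]; first by rewrite cards0.
  by rewrite (leq_trans (leq_card_setU _ _)) // leq_add.
apply: leq_sum => s _; case: (boolP (uniq s)) => us /=.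
  by rewrite card_sample.
by rewrite (_ : [set _ | _] = set0) ?cards0 //; apply/setP => phi; rewrite !inE.
Qed.

Definition triple_seq (V : Type) (E : V -> V -> V -> bool) (s : seq V) : bool :=
  if s is [:: a; b; c] then E a b c else false.

Lemma form3_ones (V : finType) (E : V -> V -> V -> bool) :
  form3 E (fun=> 1) (fun=> 1) (fun=> 1) = #|[set s : 3.-tuple V | triple_seq E s]|.
Proof.
rewrite card_tupleE (sum_tuple3 (fun s => triple_seq E s)).
by do 3!(apply: eq_bigr => ? _); rewrite !muln1.
Qed.

Definition pullback (I T : Type) (E : T -> T -> T -> bool) (phi : I -> T) i j k :=
  E (phi i) (phi j) (phi k).

Lemma triple_system_pullback (I T : Type) (E : T -> T -> T -> bool) (phi : I -> T) :
  triple_system E -> triple_system (pullback E phi).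
Proof.
case=> E12 E23 Ei; split=> i j k; rewrite /pullback; first exact: E12.
  exact: E23.
by move=> /Ei nij ij; apply: nij; rewrite ij.
Qed.

(** Count the pairs of a map phi from m points to the n vertices and an ordered
    triple of points that phi carries to a triple of E.  Each triple of distinct
    points contributes n^(m-3) times the number of triples of E.  If phi carries no
    distinct points to a fold of F6, the pullback along phi admits no homomorphism
    from F6, even if phi is not injective, and form3_F6_hom_free with unit weights
    applies.  The other phi number at most 5 m^5 n^(m-1), and each contributes at
    most m^3.  The statement is the result divided by n^(m-3). *)
Lemma F6_free_sampling_bound (T : finType) (E : T -> T -> T -> bool) m :
    triple_system E -> F6_free E -> 4 < m ->
  9 * m ^_ 3 * form3 E (fun=> 1) (fun=> 1) (fun=> 1) <=
  #|T| ^ 3 * (2 * m ^ 3 + 18 * m ^ 2) + 45 * m ^ 8 * #|T| ^ 2.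
Proof.
move=> E3 EF m4.
pose I := 'I_m; pose Phi := {ffun I -> T}; pose n := #|T|.
pose X (phi : Phi) := form3 (pullback E phi) (fun=> 1) (fun=> 1) (fun=> 1).
pose bad k (Q : pred (seq T)) :=
  [set phi : Phi | [exists s : k.-tuple I, uniq s && Q (map phi s)]].
pose B := bad 4 (fold_25 E) :|: bad 5 (fold_26 E) :|: bad 5 (fold_36 E).
have X_good phi : phi \notin B -> 9 * X phi <= 2 * m ^ 3 + 18 * m ^ 2.
  rewrite !inE !negb_or => /andP[/andP[/existsPn no4 /existsPn no26] /existsPn no36].
  have := form3_F6_hom_free (triple_system_pullback phi E3) _ (fun=> 1).
  rewrite sum_nat_const card_ord muln1; apply.
  move=> a b c d e f abc abd cde aef.
  have neq := triple_neq (triple_system_pullback phi E3).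
  case/and3P: (neq _ _ _ abc) => ab bc ac.
  case/and3P: (neq _ _ _ abd) => _ bd ad.
  case/and3P: (neq _ _ _ cde) => cd de ce.
  case/and3P: (neq _ _ _ aef) => ae _ _.
  have uniqP := (inE, negb_or, ab, bc, ac, bd, ad, cd, de, ce, ae).
  case: (hom_F6_degenerate E3 EF abc abd cde aef) => Hbad.
  - have := no4 [tuple a; d; b; c]; rewrite [map _ _]/= Hbad /= !uniqP.
    by rewrite !(eq_sym d) !uniqP.
  - have be : b != e.
      by case/and4P: Hbad => _ _ _ /(neq a e b)/and3P[_]; rewrite eq_sym.
    have := no26 [tuple b; a; c; d; e]; rewrite [map _ _]/= Hbad /= !uniqP be.
    by rewrite (eq_sym b a) !uniqP.
  - have be : b != e.
      by case/and5P: Hbad => _ _ _ _; apply: contraNneq => ->.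
    have := no36 [tuple c; a; b; d; e]; rewrite [map _ _]/= Hbad /= !uniqP be.
    by rewrite !(eq_sym c) !uniqP.
  - have be : b != e.
      by case/and5P: Hbad => _ _ _ _; apply: contraNneq => ->.
    have := no36 [tuple d; a; b; c; e]; rewrite [map _ _]/= Hbad /= !uniqP be.
    by rewrite !(eq_sym d) !uniqP.
have X_le phi : X phi <= m ^ 3.
  have := form3_le (pullback E phi) (fun=> 1).
  by rewrite sum_nat_const card_ord muln1.
have B_le : #|B| <= 5 * m ^ 5 * n ^ m.-1.
  have bad_le k (Q : pred (seq T)) c : k <= m -> 0 < k ->
      #|[set t : k.-tuple T | Q t]| <= c * n ^ k.-1 -> #|bad k Q| <= m ^ k * c * n ^ m.-1.
    move=> km k0 Qc; have := @card_sample_some I T k Q.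
    rewrite card_ord => /leq_trans; apply; rewrite -mulnA leq_mul2l.
    apply/orP; right; have -> : m.-1 = k.-1 + (m - k) by lia.
    by rewrite expnD mulnA leq_mul2r Qc orbT.
  have b4 := @bad_le 4 (fold_25 E) 3 (ltnW m4) isT (card_fold_25 E3 EF).
  have b26 := @bad_le 5 (fold_26 E) 1 m4 isT.
  have b36 := @bad_le 5 (fold_36 E) 1 m4 isT.
  rewrite !mul1n in b26 b36.
  have {}b26 := b26 (card_fold_26 E3 EF).
  have {}b36 := b36 (card_fold_36 E3 EF).
  have m45 : m ^ 4 <= m ^ 5 by rewrite leq_exp2l //; lia.
  apply: leq_trans (leq_card_setU _ _) _.
  apply: leq_trans (leq_add (leq_card_setU _ _) (leqnn _)) _.
  apply: leq_trans (leq_add (leq_add b4 b26) b36) _.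
  rewrite -!mulnDl leq_mul2r; apply/orP; right; lia.
have upper : \sum_phi 9 * X phi <= n ^ m * (2 * m ^ 3 + 18 * m ^ 2) + #|B| * (9 * m ^ 3).
  have -> : n ^ m * (2 * m ^ 3 + 18 * m ^ 2) = \sum_(phi : Phi) (2 * m ^ 3 + 18 * m ^ 2).
    by rewrite sum_nat_const card_ffun card_ord.
  have -> : #|B| * (9 * m ^ 3) = \sum_phi (if phi \in B then 9 * m ^ 3 else 0).
    by rewrite -big_mkcond sum_nat_const.
  rewrite -big_split; apply: leq_sum => phi _ /=.
  case: ifPn => [_|/X_good]; last by rewrite addn0.
  by rewrite (leq_trans _ (leq_addl _ _)) // leq_mul2l X_le.
have lower : m ^_ 3 * form3 E (fun=> 1) (fun=> 1) (fun=> 1) * n ^ (m - 3)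
    <= \sum_phi X phi.
  have XE phi : X phi = \sum_(s : 3.-tuple I) triple_seq E (map phi s).
    rewrite /X form3_ones card_tupleE; apply: eq_bigr => s _.
    by case: s => -[|a [|b [|c [|d s]]]].
  rewrite (eq_bigr _ (fun phi _ => XE phi)) exchange_big /=.
  have -> : m ^_ 3 = #|[set s : 3.-tuple I | uniq s]|.
    rewrite -[m in LHS]card_ord -card_uniq_tuples; apply: eq_card => s.
    by rewrite !inE all_predT.
  rewrite form3_ones -mulnA -sum_nat_const big_mkcond; apply: leq_sum => s _.
  rewrite inE; case: ifP => // us.
  rewrite -[m in m - 3]card_ord -(card_sample us) -sum1_card.
  by rewrite big_mkcond leq_sum // => phi _; rewrite inE; case: (triple_seq _ _).
have [n0|n_gt0] := posnP n.
  by have := form3_le E (fun=> 1); rewrite sum_nat_const muln1 -/n n0 leqn0 => /eqP->; rewrite muln0.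
rewrite -(@leq_pmul2r (n ^ (m - 3))) ?expn_gt0 ?n_gt0 // -/n.
have nm : n ^ m = n ^ 3 * n ^ (m - 3) by rewrite -expnD subnKC //; lia.
have nm1 : n ^ m.-1 = n ^ 2 * n ^ (m - 3) by rewrite -expnD; congr (_ ^ _); lia.
rewrite -big_distrr nm /= in upper; rewrite nm1 in B_le.
move: (form3 _ _ _ _) (\sum_phi _) (n ^ (m - 3)) (#|B|) lower upper B_le => e S p b.
move=> lower upper b_le.
have := leq_mul b_le (leqnn (9 * m ^ 3)).
have -> : 5 * m ^ 5 * (n ^ 2 * p) * (9 * m ^ 3) = 45 * m ^ 8 * n ^ 2 * p by ring.
rewrite mulnDl; move: (m ^_ 3) lower => q lower; lia.
Qed.

(** * The upper bound *)

Definition adj (T : finType) (G : graph3 T) a b c := [set a; b; c] \in edges G.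

Lemma set3_seq (T : finType) (a b c : T) : [set a; b; c] = [set x in [:: a; b; c]].
Proof. by apply/setP => x; rewrite !inE orbA. Qed.

Lemma triple_system_adj (T : finType) (G : graph3 T) : triple_system (adj G).
Proof.
split=> a b c; rewrite /adj.
- by rewrite (finset.setUC [set a]).
- by rewrite -!finset.setUA (finset.setUC [set b]).
move=> abc eab; have /eqP := forall_inP (edges_card3 G) _ abc.
by rewrite eab finset.setUid cards2; case: (_ != _).
Qed.

Lemma card_edges_adj (T : finType) (G : graph3 T) :
  6 * #|edges G| <= form3 (adj G) (fun=> 1) (fun=> 1) (fun=> 1).
Proof.
rewrite form3_ones.
have -> : [set s : 3.-tuple T | triple_seq (adj G) s] =
          [set s : 3.-tuple T | [set x in s] \in edges G].
  apply/setP => -[[|a [|b [|c [|d s]]]] //= i]; rewrite !inE /triple_seq /adj /=.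
  by rewrite set3_seq.
rewrite -[leqRHS]sum1_card.
rewrite (partition_big (fun s : 3.-tuple T => [set x in s]) (mem (edges G))) /=.
  2: by move=> s; rewrite inE.
rewrite mulnC -sum_nat_const; apply: leq_sum => e eG.
have /eqP e3 := forall_inP (edges_card3 G) _ eG.
have -> : 6 = #|e| ^_ 3 by rewrite e3.
rewrite -card_uniq_tuples -sum1_card.
rewrite big_mkcond [leqRHS]big_mkcond; apply: leq_sum => s _.
rewrite !inE; case: ifP => // /andP[/allP se us].
suff -> : [set x in s] = e by rewrite eG eqxx.
apply/eqP; rewrite eqEcard e3 cardsE (card_uniqP us) size_tuple leqnn andbT.
by apply/fintype.subsetP => x; rewrite inE => /se.
Qed.

Lemma F6_free_adj (T : finType) (G : graph3 T) : graph_free F6 G -> F6_free (adj G).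
Proof.
move=> FG a b c d e f us abc abd cde aef; move/negP: FG; apply.
apply/existsP; exists [ffun i : 'I_6 => nth a [:: a; b; c; d; e; f] i].
set g := finfun _; have gE k : k < 6 -> g (inord k) = nth a [:: a; b; c; d; e; f] k.
  by move=> k6; rewrite ffunE inordK.
apply/andP; split.
  by apply/injectiveP => i j /eqP; rewrite !ffunE nth_uniq // => /eqP/val_inj.
apply/fintype.subsetP => _ /imsetP[h hF ->].
by move: hF; rewrite !inE -!orbA => /or4P[] /eqP ->; rewrite !imsetU !imset_set1 !gE.
Qed.

(** Replacing m^_3 by m^3 in the sampling bound raises 2m + 18 to 2m + 45.  The lower
    bound on n makes all terms of order n^2, including those from replacing n^3 by
    n^_3, add up to at most one n^_3, whence 2m + 46. *)
Lemma turan_number_F6_le m n : 4 < m -> 45 * m ^ 6 + 6 * m + 138 <= n ->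
  9 * m * turan_number n F6 <= (2 * m + 46) * 'C(n, 3).
Proof.
move=> m4 nm; rewrite -(@leq_pmul2r 6) //.
have -> : (2 * m + 46) * 'C(n, 3) * 6 = (2 * m + 46) * n ^_ 3.
  by rewrite -mulnA -(bin_ffact n 3).
rewrite -mulnA mulnC mulnA [X in X * _]mulnC.
have : turan_number n F6 <= (2 * m + 46) * n ^_ 3 %/ (6 * (9 * m)).
  apply/bigmax_leqP => G FG; rewrite leq_divRL; last by lia.
  have := F6_free_sampling_bound (triple_system_adj G) (F6_free_adj FG) m4.
  have := form3_le (adj G) (fun=> 1); have := card_edges_adj G.
  rewrite sum_nat_const card_ord muln1.
  move: (form3 _ _ _ _) (#|edges G|) => X e eX Xn main.
  have step : 9 * m * X <= n ^ 3 * (2 * m + 45) + 45 * m ^ 6 * n ^ 2.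
    rewrite -(@leq_pmul2l (m ^ 2)); last by rewrite expn_gt0; lia.
    have mE : m ^_ 3 + 3 * m ^ 2 = m ^ 3 + 2 * m.
      case: m m4 {nm main} => [|[|m]] // _; rewrite !ffactSS ffactn1; ring.
    have : 9 * m ^ 3 * X <= 9 * m ^_ 3 * X + 27 * m ^ 2 * n ^ 3.
      have := leq_mul (leqnn (m ^ 2)) Xn; nia.
    nia.
  have nE : n ^_ 3 + 3 * n ^ 2 = n ^ 3 + 2 * n.
    case: n {nm Xn main step G FG} => [|[|n]] //.
    by rewrite !ffactSS ffactn1; ring.
  have small : n ^ 2 * (45 * m ^ 6 + 6 * m + 135) <= n ^_ 3.
    have : n ^ 2 * (45 * m ^ 6 + 6 * m + 138) <= n ^ 3 by rewrite (expnSr n 2) leq_mul2l nm orbT.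
    lia.
  nia.
rewrite leq_divRL; last by lia.
by rewrite mulnC; lia.
Qed.

(** * The lower bound *)

(** The edges of the complete 3-partite 3-graph on the residue classes mod 3. *)
Definition rainbow_edges n : {set {set 'I_n}} :=
  [set e : {set 'I_n} | (#|e| == 3) &&
     [forall x in e, forall y in e, (x == y %[mod 3]) ==> (x == y)]].

Fact rainbow_edges_card3 n : [forall e in rainbow_edges n, #|e| == 3].
Proof. by apply/forall_inP => e; rewrite inE => /andP[]. Qed.

Definition tripartite n := Graph3 (@rainbow_edges_card3 n).

Lemma tripartite_F6_free n : graph_free F6 (tripartite n).
Proof.
apply/negP => /existsP[f /andP[/injectiveP f_inj /fintype.subsetP fF]].
have col h i j : h \in edges F6 -> inord i \in h -> inord j \in h ->
    i < 6 -> j < 6 -> i != j -> f (inord i) != f (inord j) %[mod 3].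
  move=> hF ih jh i6 j6 ij; have := fF _ (imset_f (fun e : {set 'I_6} => f @: e) hF).
  rewrite inE => /andP[_ /forall_inP/(_ _ (imset_f f ih))].
  move=> /forall_inP/(_ _ (imset_f f jh)); apply: contraTN => ->.
  by rewrite (inj_eq f_inj) -val_eqE /= !inordK.
pose h i j k : {set 'I_6} := [set inord i; inord j; inord k].
have F6E : [/\ h 0 1 2 \in edges F6, h 0 1 3 \in edges F6 & h 2 3 4 \in edges F6].
  by rewrite !inE !eqxx ?orbT.
case: F6E => h1 h2 h3.
have c01 := col _ 0 1 h1; have c02 := col _ 0 2 h1; have c12 := col _ 1 2 h1.
have c03 := col _ 0 3 h2; have c13 := col _ 1 3 h2; have c23 := col _ 2 3 h3.
rewrite !inE !eqxx ?orbT /= in c01 c02 c12 c03 c13 c23.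
move: (c01 isT isT isT isT isT) (c02 isT isT isT isT isT) (c12 isT isT isT isT isT).
move: (c03 isT isT isT isT isT) (c13 isT isT isT isT isT) (c23 isT isT isT isT isT).
lia.
Qed.

Lemma card_tripartite n :
  (n + 2) %/ 3 * ((n + 1) %/ 3) * (n %/ 3) <= #|edges (tripartite n)|.
Proof.
case: n => [|n]; first by rewrite muln0.
set p := (n.+1 + 2) %/ 3; set q := (n.+1 + 1) %/ 3; set r := n.+1 %/ 3.
pose h (t : 'I_p * 'I_q * 'I_r) : {set 'I_n.+1} :=
  [set inord (3 * t.1.1); inord (3 * t.1.2 + 1); inord (3 * t.2 + 2)].
have lt_a (a : 'I_p) : 3 * a < n.+1 by have := ltn_ord a; rewrite {2}/p; lia.
have lt_b (b : 'I_q) : 3 * b + 1 < n.+1 by have := ltn_ord b; rewrite {2}/q; lia.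
have lt_c (c : 'I_r) : 3 * c + 2 < n.+1 by have := ltn_ord c; rewrite {2}/r; lia.
have h_inj : injective h.
  move=> [[a b] c] [[a' b'] c'] /= /setP hh.
  have := hh (inord (3 * a)); have := hh (inord (3 * b + 1)); have := hh (inord (3 * c + 2)).
  rewrite !inE !eqxx ?orbT /= -!val_eqE /= !inordK // => ec eb ea.
  by congr (_, _, _); apply: val_inj => /=; lia.
rewrite -[p]card_ord -[q]card_ord -[r]card_ord -!card_prod -(card_imset _ h_inj).
apply/subset_leq_card/fintype.subsetP => _ /imsetP[[[a b] c] _ ->].
rewrite inE; apply/andP; split.
  rewrite /h -finset.setUA !cardsU1 cards1 !inE -!val_eqE /= !inordK //.
  by lia.
apply/forall_inP => x; rewrite !inE -!val_eqE /= !inordK // => hx.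
apply/forall_inP => y; rewrite !inE -!val_eqE /= !inordK // => hy.
by lia.
Qed.

(** The product of the part sizes is at least n(n-1)(n-2)/27 for every n, so the
    bound holds without an error term. *)
Lemma turan_number_F6_ge n : 2 * 'C(n, 3) <= 9 * turan_number n F6.
Proof.
have : #|edges (tripartite n)| <= turan_number n F6.
  exact: (leq_bigmax_cond (tripartite n) (tripartite_F6_free n)).
move/(leq_trans (card_tripartite n)); move: (turan_number _ _) => t pqr.
rewrite -(@leq_pmul2r 6) // -mulnA (bin_ffact n 3).
have : 2 * n ^_ 3 <= 54 * ((n + 2) %/ 3 * ((n + 1) %/ 3) * (n %/ 3)).
  have nE : n = 3 * (n %/ 3) + n %% 3 by lia.
  have := ltn_pmod n (isT : 0 < 3).
  have -> : (n + 2) %/ 3 = n %/ 3 + (0 < n %% 3) by lia.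
  have -> : (n + 1) %/ 3 = n %/ 3 + (1 < n %% 3) by lia.
  rewrite [in n ^_ 3]nE !ffactnSr ffactn0.
  move: (n %/ 3) (n %% 3) => k [|[|[|//]]] _; case: k => [|k] //; nia.
by lia.
Qed.

(** * The limit *)

Import Order.TTheory GRing.Theory Num.Theory.
Import numFieldNormedType.Exports.

Local Open Scope ring_scope.

Lemma turan_ratio_F6_ge (R : realType) n : (3 <= n)%N ->
  2 / 9 <= turan_ratio R F6 n.
Proof.
move=> n3; have C0 : 0 < 'C(n, 3)%:R :> R by rewrite ltr0n bin_gt0.
have := turan_number_F6_ge n; rewrite -(ler_nat R) !natrM => le.
by rewrite /turan_ratio ler_pdivlMr //; lra.
Qed.

Lemma turan_ratio_F6_le (R : realType) m n :
    (4 < m)%N -> (45 * m ^ 6 + 6 * m + 138 <= n)%N ->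
  turan_ratio R F6 n <= 2 / 9 + 6 / m%:R.
Proof.
move=> m4 nm; have C0 : 0 < 'C(n, 3)%:R :> R by rewrite ltr0n bin_gt0; lia.
have m0 : 0 < m%:R :> R by rewrite ltr0n; lia.
have := turan_number_F6_le m4 nm; rewrite -(ler_nat R) !natrM natrD natrM => le.
rewrite /turan_ratio ler_pdivrMr // -(ler_pM2l m0).
have -> : m%:R * ((2 / 9 + 6 / m%:R) * 'C(n, 3)%:R) =
    (2 / 9 * m%:R + 6) * 'C(n, 3)%:R :> R by field; lra.
lra.
Qed.

Theorem corollary5 (R : realType) : turan_density R F6 = 2 / 9.
Proof.
apply: cvg_lim => //; apply/cvgrPdist_le => e e0.
pose m := (Num.truncn (6 / e) + 5)%N.
have m_e : 6 / m%:R <= e.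
  have m0 : 0 < m%:R :> R by rewrite ltr0n /m; lia.
  rewrite ler_pdivrMr // mulrC -ler_pdivrMr // ltW //.
  apply: lt_le_trans (truncnS_gt _) _; rewrite ler_nat -[leqLHS]addn1 leq_add2l //.
exists (45 * m ^ 6 + 6 * m + 138)%N => // n /= nm.
have m4 : (4 < m)%N by rewrite /m; lia.
have lo : 2 / 9 <= turan_ratio R F6 n by apply: turan_ratio_F6_ge; lia.
have hi := turan_ratio_F6_le R m4 nm.
by rewrite ler_norml; lra.
Qed.
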